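(* Let $n\ge 2$ be even, let $\mathscr{C}_H\subseteq\mathbb{F}_2^{2^n-1}$ be the $[2^n-1,\,2^n-1-n,\,3]$ Hamming code, let $\mathbf{v}_1,\ldots,\mathbf{v}_{|\mathcal{C}_e|}$ be the elements of its subset $\mathcal{C}_e$ of even-weight codewords, and let $A$ be the adjacency matrix of the graph on $\mathcal{C}_e$ in which two elements are adjacent iff their Hamming distance is $4$. Then the minimum eigenvalue of $A$ is $$\lambda_{\min}=-\frac{(2^n-1)(2^n-4)}{12},$$ and an eigenvector of $A$ corresponding to $\lambda_{\min}$ is given by $\mathbf{e}_{\mathbf{u}}=\bigl[(-1)^{\mathbf{u}\cdot\mathbf{v}_1},(-1)^{\mathbf{u}\cdot\mathbf{v}_2},\ldots,(-1)^{\mathbf{u}\cdot\mathbf{v}_{|\mathcal{C}_e|}}\bigr]^\top$, where $\mathbf{u}\in\mathbb{F}_2^{2^n-1}$ is the punctured truth table of a bent function $f_{\mathbf{u}}:\mathbb{F}_2^n\to\{0,1\}$ with $f_{\mathbf{u}}(\mathbf{0})=0$ (any such bent function).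
   Context: The $[2^n-1,\,2^n-1-n,\,3]$ Hamming code is the kernel over $\mathbb{F}_2$ of the $n\times(2^n-1)$ matrix $H$ whose columns are all the nonzero vectors of $\mathbb{F}_2^n$, listed in lexicographic order. The punctured truth table of $f:\mathbb{F}_2^n\to\{0,1\}$ is the vector in $\mathbb{F}_2^{2^n-1}$ listing the values $f(\mathbf{x})$ for nonzero $\mathbf{x}$ in lexicographic order. A function $f:\mathbb{F}_2^n\to\{0,1\}$ is bent if $\bigl|\sum_{\mathbf{x}\in\mathbb{F}_2^n}(-1)^{f(\mathbf{x})+\mathbf{a}\cdot\mathbf{x}}\bigr|=2^{n/2}$ for all $\mathbf{a}\in\mathbb{F}_2^n$. $\mathbf{u}\cdot\mathbf{v}$ is the $\mathbb{F}_2$ inner product. The rows and columns of $A$ are indexed by $\mathbf{v}_1,\ldots,\mathbf{v}_{|\mathcal{C}_e|}$. *)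

(* Defs.v *)
From mathcomp Require Import all_boot all_order all_algebra.

Set Implicit Arguments.
Unset Strict Implicit.
Unset Printing Implicit Defensive.

Import Order.TTheory GRing.Theory Num.Theory.

Local Open Scope ring_scope.

(* Lexicographic order with coordinate 0 the most significant. *)
Definition lex_le (n : nat) (x y : 'rV['F_2]_n) : bool :=
  (([seq (x 0 i : nat) | i <- enum 'I_n] : seqlexi nat) <=
   ([seq (y 0 i : nat) | i <- enum 'I_n] : seqlexi nat))%O.

Definition nonzero_vectors (n : nat) : seq 'rV['F_2]_n :=
  sort (@lex_le n) [seq x <- enum 'rV['F_2]_n | x != 0].

(* The list has exactly 2 ^ n - 1 entries, so the default value of nth is
   never reached. *)
Definition nonzero_vector (n : nat) (j : 'I_(2 ^ n - 1)) : 'rV['F_2]_n :=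
  nth 0 (nonzero_vectors n) j.

Definition hamming_mx (n : nat) : 'M['F_2]_(n, 2 ^ n - 1) :=
  \matrix_(i, j) nonzero_vector j 0 i.

Definition hamming_code (n : nat) : {set 'rV['F_2]_(2 ^ n - 1)} :=
  [set w | hamming_mx n *m w^T == 0].

Definition hamming_weight (m : nat) (x : 'rV['F_2]_m) : nat :=
  #|[set i | x 0 i != 0]|.

Definition hamming_dist (m : nat) (x y : 'rV['F_2]_m) : nat :=
  #|[set i | x 0 i != y 0 i]|.

Definition even_code (n : nat) : {set 'rV['F_2]_(2 ^ n - 1)} :=
  [set w in hamming_code n | ~~ odd (hamming_weight w)].

Definition dotp (m : nat) (x y : 'rV['F_2]_m) : 'F_2 :=
  \sum_i x 0 i * y 0 i.

(* The halving is exact for even n; for odd n no f satisfies the condition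
   (by Parseval), just as none satisfies it with the real power 2 ^ (n / 2). *)
Definition bent (n : nat) (f : 'rV['F_2]_n -> bool) : Prop :=
  forall a : 'rV['F_2]_n,
    `|\sum_x (-1) ^+ (f x + dotp a x)%N| = 2 ^+ n./2 :> int.

Definition punctured_tt (n : nat) (f : 'rV['F_2]_n -> bool) :
    'rV['F_2]_(2 ^ n - 1) :=
  \row_j (f (nonzero_vector j))%:R.

Definition adjacency_mx (R : pzRingType) (T : Type) (e : rel T) (m : nat)
    (v : 'I_m -> T) : 'M[R]_m :=
  \matrix_(i, j) (e (v i) (v j))%:R.

Definition is_min_eigenvalue (R : realFieldType) (m : nat) (A : 'M[R]_m)
    (a : R) : Prop :=
  eigenvalue A a /\ (forall b, eigenvalue A b -> a <= b).

(* mxalgebra's [eigenvalue] and [eigenspace] use row vectors; eigenvectors here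
   are columns. *)
Definition is_eigenvector (R : fieldType) (m : nat) (A : 'M[R]_m) (a : R)
    (x : 'cV[R]_m) : Prop :=
  x != 0 /\ A *m x = a *: x.

Definition sign_vector (R : pzRingType) (N m : nat) (u : 'rV['F_2]_N)
    (v : 'I_m -> 'rV['F_2]_N) : 'cV[R]_m :=
  \col_i (-1) ^+ (dotp u (v i) : nat).

(* Main.v *)
Require Import Defs.
From mathcomp Require Import all_boot all_order all_algebra.
From mathcomp Require Import ring zify.

(** The graph is the Cayley graph of the group of even-weight codewords with
    respect to the codewords of weight 4, so its eigenvalues are the character
    sums [lambda_u], the sum of [(-1)^(u.w)] over the weight-4 codewords [w].
    Let [W'(a)] be the sum of [(-1)^(u_x + a.x)] over [x <> 0], and [N = 2^n].
    Expanding the fourth power and separating the degenerate quadruples gives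
    [sum_a W'(a)^4 = N (24 lambda_u + 3 (N-1)^2 - 2 (N-1))], while
    [sum_a W'(a)^2 = N (N-1)].  With [q = 2^(n/2)] even, [W'(a)] is odd, so
    [W'(a)^2] never lies strictly between the consecutive odd squares
    [(q-1)^2] and [(q+1)^2]; summing
    [(W'(a)^2 - (q-1)^2) (W'(a)^2 - (q+1)^2) >= 0] over [a] yields the bound.
    For bent [f] with [f 0 = 0], [W'(a) + 1] is [q] or [-q] and every summand
    vanishes. *)

Set Implicit Arguments.
Unset Strict Implicit.
Unset Printing Implicit Defensive.

Import Order.TTheory GRing.Theory Num.Theory.

Local Open Scope ring_scope.

(** * Arithmetic and signs over F_2 *)

Lemma F2_cases (a : 'F_2) : a = 0 \/ a = 1.
Proof.
by case: a => [[|[|m]] lt_m]; [left | right | by []]; apply: val_inj.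
Qed.

Lemma F2_nat_of_neq0 (a : 'F_2) : a = (a != 0)%:R.
Proof. by case: (F2_cases a) => ->. Qed.

Lemma F2_addxx (a : 'F_2) : a + a = 0.
Proof. by case: (F2_cases a) => ->; apply: val_inj. Qed.

Lemma dotpDr n (a x y : 'rV['F_2]_n) : dotp a (x + y) = dotp a x + dotp a y.
Proof. by rewrite -big_split; apply: eq_bigr => i _; rewrite mxE mulrDr. Qed.

Lemma dotpC n (x y : 'rV['F_2]_n) : dotp x y = dotp y x.
Proof. by apply: eq_bigr => i _; rewrite mulrC. Qed.

Lemma dotpDl n (a b x : 'rV['F_2]_n) : dotp (a + b) x = dotp a x + dotp b x.
Proof. by rewrite dotpC dotpDr !(dotpC x). Qed.

Lemma dotp_delta n (x : 'rV['F_2]_n) i : dotp (delta_mx 0 i) x = x 0 i.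
Proof.
rewrite /dotp (bigD1 i) //= mxE !eqxx mul1r big1 ?addr0 // => j /negPf ji.
by rewrite mxE ji mul0r.
Qed.

Lemma dotp0 n (a : 'rV['F_2]_n) : dotp a 0 = 0.
Proof. by apply: big1 => i _; rewrite mxE mulr0. Qed.

Lemma rV_F2_addxx n (x : 'rV['F_2]_n) : x + x = 0.
Proof. by apply/rowP => i; rewrite !mxE F2_addxx. Qed.

Lemma rV_F2_opp n (x : 'rV['F_2]_n) : - x = x.
Proof. by apply/eqP; rewrite eq_sym -addr_eq0 rV_F2_addxx. Qed.

Section Sign.
Variable R : numDomainType.

Definition sign (a : 'F_2) : R := (-1) ^+ (a : nat).

Lemma sign0 : sign 0 = 1. Proof. by []. Qed.

Lemma signD a b : sign (a + b) = sign a * sign b.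
Proof.
by case: (F2_cases a) => ->; case: (F2_cases b) => ->;
  rewrite /sign ?expr0 ?expr1 /= ?mul1r ?mulr1 ?mulrNN ?mul1r.
Qed.

Lemma sign_sqr a : sign a * sign a = 1.
Proof. by rewrite -expr2 sqrr_sign. Qed.

(** Translating [a] by a basis vector at a coordinate where [x] is nonzero flips every sign, so the
    sum equals its own opposite. *)
Lemma sum_sign_dotp n (x : 'rV['F_2]_n) :
  \sum_a sign (dotp a x) = if x == 0 then 2 ^+ n else 0.
Proof.
case: eqP => [-> | /eqP x_neq0].
  rewrite (eq_bigr (fun=> 1)) => [|a _]; last by rewrite dotp0.
  by rewrite sumr_const card_mx card_Fp // mul1n natrX.
have /rV0Pn[i xi] := x_neq0.
set S := \sum_a _; have : S = - S.
  rewrite {1}/S (reindex_inj (addrI (delta_mx 0 i))) -mulN1r mulr_sumr.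
  apply: eq_bigr => a _; rewrite dotpDl signD dotp_delta.
  by case: (F2_cases (x 0 i)) xi => ->; rewrite ?eqxx.
by move=> /eqP; rewrite -addr_eq0 -mulr2n mulrn_eq0 => /eqP.
Qed.

End Sign.

(** * Enumeration of the nonzero vectors *)

Lemma uniq_nonzero_vectors n : uniq (nonzero_vectors n).
Proof. by rewrite sort_uniq filter_uniq ?enum_uniq. Qed.

Lemma mem_nonzero_vectors n x : (x \in nonzero_vectors n) = (x != 0).
Proof. by rewrite mem_sort mem_filter mem_enum andbT. Qed.

Lemma size_nonzero_vectors n : size (nonzero_vectors n) = (2 ^ n - 1)%N.
Proof.
have /card_uniqP <- := uniq_nonzero_vectors n.
rewrite (eq_card (mem_nonzero_vectors (n := n))).
have := cardC1 (0 : 'rV['F_2]_n); rewrite card_mx card_Fp // mul1n -subn1 => <-.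
by apply: eq_card.
Qed.

Lemma nonzero_vector_inj n : injective (@nonzero_vector n).
Proof.
move=> i j /eqP; rewrite nth_uniq ?size_nonzero_vectors //;
  last exact: uniq_nonzero_vectors.
by move=> /eqP/val_inj.
Qed.

Lemma sum_nonzero_vector (V : nmodType) n (F : 'rV['F_2]_n -> V) :
  \sum_j F (nonzero_vector j) = \sum_(x | x != 0) F x.
Proof.
rewrite (eq_bigl (mem (nonzero_vectors n))); last first.
  by move=> x; rewrite inE mem_nonzero_vectors.
rewrite -big_uniq ?uniq_nonzero_vectors //= (big_nth 0) size_nonzero_vectors.
by rewrite big_mkord.
Qed.

(** * Weights, supports and parity checks *)

Definition support n (w : 'rV['F_2]_n) : {set 'I_n} := [set i | w 0 i != 0].

Lemma natr_hamming_weight n (w : 'rV['F_2]_n) :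
  (hamming_weight w)%:R = \sum_i w 0 i.
Proof.
rewrite /hamming_weight -sum1_card natr_sum big_mkcond.
apply: eq_bigr => i _; rewrite inE [RHS]F2_nat_of_neq0.
by case: (w 0 i != 0).
Qed.

(** Modulo 2 the weight is the coordinate sum, so evenness is a linear condition; this is why the
    even codewords form a group. *)
Lemma odd_hamming_weight n (w : 'rV['F_2]_n) :
  odd (hamming_weight w) = (\sum_i w 0 i != 0).
Proof.
rewrite -natr_hamming_weight -(inj_eq val_inj) /= Zp_nat /= modn2 eqb0.
by rewrite negbK.
Qed.

Lemma hamming_distE n (x y : 'rV['F_2]_n) :
  hamming_dist x y = hamming_weight (x + y).
Proof.
apply: eq_card => i; rewrite !inE -{2}(rV_F2_opp y) !mxE subr_eq0 //.
Qed.

Lemma even_code_add n (x y : 'rV['F_2]_(2 ^ n - 1)) :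
  x \in even_code n -> y \in even_code n -> x + y \in even_code n.
Proof.
rewrite !inE !odd_hamming_weight !negbK.
move=> /andP[/eqP Hx /eqP sx] /andP[/eqP Hy /eqP sy].
rewrite linearD mulmxDr Hx Hy addr0 eqxx /=.
rewrite (eq_bigr (fun i => x 0 i + y 0 i)) => [|i _]; last by rewrite mxE.
by rewrite big_split /= sx sy addr0.
Qed.

(** The syndrome of [w] is the sum of the columns selected by its support. *)
Lemma hamming_codeE n (w : 'rV['F_2]_(2 ^ n - 1)) :
  (w \in hamming_code n) = (\sum_(j in support w) nonzero_vector j == 0).
Proof.
rewrite inE -(inj_eq trmx_inj) trmx0; congr (_ == _).
apply/rowP => i; rewrite !mxE summxE [RHS]big_mkcond.
apply: eq_bigr => j _; rewrite !mxE inE [w 0 j]F2_nat_of_neq0.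
by case: (w 0 j != 0); rewrite ?mulr1 ?mulr0.
Qed.

(** * Walsh sums and their second moment *)

(** Connection set of the Cayley graph; weight 4 already implies evenness. *)
Definition weight4_code n : {set 'rV['F_2]_(2 ^ n - 1)} :=
  [set w in hamming_code n | hamming_weight w == 4%N].

(** Generic in [R]: the estimates run over [int] and are then cast into the field. *)
Definition char_sum (R : numDomainType) n (u : 'rV['F_2]_(2 ^ n - 1)) : R :=
  \sum_(w in weight4_code n) sign R (dotp u w).

(* The Walsh transform at a of the function with punctured truth table u,
   without the term at x = 0. *)
Definition walsh n (u : 'rV['F_2]_(2 ^ n - 1)) (a : 'rV['F_2]_n) : int :=
  \sum_j sign int (u 0 j + dotp a (nonzero_vector j)).

(** An odd number, 2^n - 1, of terms, each 1 or -1. *)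
Lemma walsh_odd n (u : 'rV['F_2]_(2 ^ n - 1)) a :
  (0 < n)%N -> exists z, walsh u a = 2 * z + 1.
Proof.
move=> n_gt0.
have signE b : sign int b = 1 - 2 * (b != 0)%:R by case: (F2_cases b) => ->.
rewrite /walsh (eq_bigr _ (fun j _ => signE _)) sumrB -mulr_sumr.
rewrite sumr_const card_ord; set z := \sum_j _.
exists ((2 ^ n.-1)%:R - 1 - z).
rewrite -{1}(prednK n_gt0) expnS natrB ?muln_gt0 ?expn_gt0 // natrM; ring.
Qed.

(** The index type is arbitrary so that squaring can be iterated: first over indices, then over
    pairs. *)
Lemma sqr_sum_sign n (I : finType) (U : I -> 'F_2) (H : I -> 'rV['F_2]_n) a :
  (\sum_i sign int (U i + dotp a (H i))) ^+ 2 =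
  \sum_p sign int (U p.1 + U p.2 + dotp a (H p.1 + H p.2)).
Proof.
rewrite expr2 big_distrlr /= pair_bigA /=; apply: eq_bigr => p _.
by rewrite -signD dotpDr addrACA.
Qed.

(** Orthogonality of characters: summing over [a] keeps only the zero-sum terms. *)
Lemma sum_sum_sign n (I : finType) (U : I -> 'F_2) (H : I -> 'rV['F_2]_n) :
  \sum_a \sum_i sign int (U i + dotp a (H i)) =
  2 ^+ n * \sum_(i | H i == 0) sign int (U i).
Proof.
rewrite exchange_big mulr_sumr [RHS]big_mkcond; apply: eq_bigr => i _.
under eq_bigr do rewrite signD.
by rewrite -mulr_sumr sum_sign_dotp; case: eqP; rewrite ?mulr0 // mulrC.
Qed.

Lemma nonzero_vector_add_eq0 n (i j : 'I_(2 ^ n - 1)) :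
  (nonzero_vector i + nonzero_vector j == 0) = (i == j).
Proof. by rewrite addr_eq0 rV_F2_opp (inj_eq (@nonzero_vector_inj n)). Qed.

Lemma card_nonzero_vector n : (2 ^ n - 1)%N%:R = 2 ^+ n - 1 :> int.
Proof. by rewrite natrB ?expn_gt0 // natrX. Qed.

(** Only diagonal pairs sum to zero, and each of these contributes 1. *)
Lemma walsh_moment2 n (u : 'rV['F_2]_(2 ^ n - 1)) :
  \sum_a walsh u a ^+ 2 = 2 ^+ n * (2 ^+ n - 1).
Proof.
rewrite /walsh; under eq_bigr do rewrite sqr_sum_sign.
rewrite (sum_sum_sign (fun p : _ * _ => u 0 p.1 + u 0 p.2)
  (fun p => nonzero_vector p.1 + nonzero_vector p.2)); congr (_ * _).
rewrite big_mkcond -(pair_bigA _ (fun i j =>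
  if nonzero_vector i + nonzero_vector j == 0 then sign int (u 0 i + u 0 j)
  else 0)) /= -card_nonzero_vector -[in RHS](card_ord (2 ^ n - 1)) -sumr_const.
apply: eq_bigr => i _; under eq_bigr do rewrite nonzero_vector_add_eq0 eq_sym.
by rewrite -big_mkcond big_pred1_eq signD sign_sqr.
Qed.

(** * Zero-sum quadruples *)

Lemma sum_quad (V : nmodType) (J : finType) (F : (J * J) * (J * J) -> V) :
  \sum_q F q = \sum_i \sum_j \sum_k \sum_l F ((i, j), (k, l)).
Proof.
rewrite pair_bigA; under eq_bigr do rewrite pair_bigA.
rewrite pair_bigA; apply: eq_bigr => -[[i j] [k l]] _ //.
Qed.

(* For a zero-sum quadruple, the summand is the indicator of having a repeated
   entry: the entries then agree in pairs, and quadruples with all entries equal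
   are counted three times. *)
Lemma sum_quad_pairing (J : finType) :
  \sum_(q : (J * J) * (J * J))
    ((q.1.1 == q.1.2)%:R * (q.2.1 == q.2.2)%:R +
     (q.1.1 == q.2.1)%:R * (q.1.2 == q.2.2)%:R +
     (q.1.1 == q.2.2)%:R * (q.1.2 == q.2.1)%:R -
     2 * (q.1.1 == q.1.2)%:R * (q.1.2 == q.2.1)%:R * (q.2.1 == q.2.2)%:R)
  = 3 * #|J|%:R ^+ 2 - 2 * #|J|%:R :> int.
Proof.
have sum_eq (c : int) (j : J) : \sum_k c * (j == k)%:R = c.
  rewrite (bigD1 j) //= eqxx mulr1 big1 ?addr0 // => k /negPf.
  by rewrite eq_sym => ->; rewrite mulr0.
have sum_const (c : int) : \sum_(k : J) c = c * #|J|%:R.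
  by rewrite sumr_const mulr_natr.
have sum_eq1 (j : J) : \sum_k (j == k)%:R = 1 :> int.
  by under eq_bigr do rewrite -[_%:R]mul1r.
rewrite sumrB !big_split /= !sum_quad /=.
have -> : \sum_(i : J) \sum_(j : J) \sum_(k : J) \sum_(l : J)
    (i == j)%:R * (k == l)%:R = #|J|%:R ^+ 2 :> int.
  under eq_bigr do under eq_bigr do under eq_bigr do rewrite sum_eq.
  under eq_bigr do under eq_bigr do rewrite sum_const mulrC.
  by under eq_bigr do rewrite sum_eq; rewrite sum_const.
have -> : \sum_(i : J) \sum_(j : J) \sum_(k : J) \sum_(l : J)
    (i == k)%:R * (j == l)%:R = #|J|%:R ^+ 2 :> int.
  under eq_bigr do under eq_bigr do under eq_bigr do rewrite sum_eq.
  under eq_bigr do under eq_bigr do rewrite sum_eq1.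
  by under eq_bigr do rewrite sum_const; rewrite sum_const mul1r.
have -> : \sum_(i : J) \sum_(j : J) \sum_(k : J) \sum_(l : J)
    (i == l)%:R * (j == k)%:R = #|J|%:R ^+ 2 :> int.
  under eq_bigr do under eq_bigr do under eq_bigr do
    under eq_bigr do rewrite mulrC.
  under eq_bigr do under eq_bigr do under eq_bigr do rewrite sum_eq.
  under eq_bigr do under eq_bigr do rewrite sum_eq1.
  by under eq_bigr do rewrite sum_const; rewrite sum_const mul1r.
have -> : \sum_(i : J) \sum_(j : J) \sum_(k : J) \sum_(l : J)
    2 * (i == j)%:R * (j == k)%:R * (k == l)%:R = 2 * #|J|%:R :> int.
  under eq_bigr do under eq_bigr do under eq_bigr do rewrite sum_eq.
  under eq_bigr do under eq_bigr do rewrite sum_eq.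
  by under eq_bigr do rewrite sum_eq; rewrite sum_const.
ring.
Qed.

(** Quadruples are pairs of pairs, the index type produced by squaring twice. *)
Definition quad_seq (J : Type) (q : (J * J) * (J * J)) : seq J :=
  [:: q.1.1; q.1.2; q.2.1; q.2.2].

(** These are the 4! orderings of [A]. *)
Lemma card_quad_uniq (J : finType) (A : {set J}) : #|A| = 4%N ->
  #|[set q : (J * J) * (J * J) | all (mem A) (quad_seq q) & uniq (quad_seq q)]|
  = 24%N.
Proof.
move=> A4; have := card_uniq_tuples 4 (mem A); rewrite A4 => card_t.
pose f (q : (J * J) * (J * J)) := [tuple q.1.1; q.1.2; q.2.1; q.2.2].
have f_inj : injective f.
  by move=> [[a b] [c d]] [[a' b'] [c' d']] /= [-> -> -> ->].
rewrite -(card_imset _ f_inj); transitivity (4 ^_ 4); last by [].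
rewrite -card_t; apply: eq_card => t; rewrite [RHS]inE.
apply/imsetP/idP => [[q] | At]; first by rewrite inE => qA ->.
exists ((tnth t 0, tnth t 1), (tnth t 2%:R, tnth t 3%:R)).
  by rewrite inE; move: At; case/tupleP: t => a t; case/tupleP: t => b t;
     case/tupleP: t => c t; case/tupleP: t => d t; rewrite (tuple0 t).
case/tupleP: t {At} => a t; case/tupleP: t => b t.
by case/tupleP: t => c t; case/tupleP: t => d t; rewrite (tuple0 t);
  apply: val_inj.
Qed.

Definition indicator N (s : seq 'I_N) : 'rV['F_2]_N := \row_j (j \in s)%:R.

Lemma support_indicator N (s : seq 'I_N) : support (indicator s) =i s.
Proof. by move=> j; rewrite inE mxE; case: (j \in s). Qed.

Lemma indicator_support N (w : 'rV['F_2]_N) s :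
  support w =i s -> indicator s = w.
Proof. by move=> ws; apply/rowP => j; rewrite mxE -ws inE -F2_nat_of_neq0. Qed.

Lemma sum_quad_seq (V : nmodType) (J : Type) (F : J -> V) q :
  \sum_(j <- quad_seq q) F j = F q.1.1 + F q.1.2 + (F q.2.1 + F q.2.2).
Proof. by rewrite !big_cons big_nil addr0 !addrA. Qed.

Lemma indicator_weight4 n (q : ('I_(2 ^ n - 1) * 'I_(2 ^ n - 1)) * _) :
  uniq (quad_seq q) ->
  (indicator (quad_seq q) \in weight4_code n) =
  (\sum_(j <- quad_seq q) nonzero_vector j == 0).
Proof.
move=> uq; rewrite inE hamming_codeE (eq_bigl _ _ (@support_indicator _ _)).
rewrite -big_uniq //= andbC.
rewrite /hamming_weight -/(support _) (eq_card (@support_indicator _ _)).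
by rewrite (card_uniqP uq).
Qed.

Lemma dotp_indicator N (u : 'rV['F_2]_N) s : uniq s ->
  dotp u (indicator s) = \sum_(j <- s) u 0 j.
Proof.
move=> us; rewrite big_uniq //= [RHS]big_mkcond; apply: eq_bigr => j _.
by rewrite mxE; case: (j \in s); rewrite ?mulr1 ?mulr0.
Qed.

(** Grouping quadruples by their set of entries, each weight-4 codeword arises from the 24 orderings
    of its support, all with the same sign. *)
Lemma sum_uniq_quad n (u : 'rV['F_2]_(2 ^ n - 1)) :
  \sum_(q | (\sum_(j <- quad_seq q) nonzero_vector j == 0) && uniq (quad_seq q))
    sign int (\sum_(j <- quad_seq q) u 0 j) = 24 * char_sum int u.
Proof.
rewrite (partition_big (fun q => indicator (quad_seq q))
                       (mem (weight4_code n))) /=;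
  last by move=> q /andP[q0 uq]; rewrite indicator_weight4.
rewrite mulr_sumr; apply: eq_bigr => w w4.
have [/= wH /eqP wt4] : w \in hamming_code n /\ hamming_weight w == 4%N.
  by move: w4; rewrite inE => /andP[].
rewrite (eq_bigr (fun=> sign int (dotp u w))); last first.
  by move=> q /andP[/andP[_ uq] /eqP<-]; rewrite dotp_indicator.
rewrite sumr_const -(card_quad_uniq wt4) mulr_natl; congr (_ *+ _).
apply: eq_card => q; rewrite [RHS]inE.
rewrite -[LHS]/((\sum_(j <- quad_seq q) nonzero_vector j == 0) &&
  uniq (quad_seq q) && (indicator (quad_seq q) == w)).
apply/andP/andP => [[/andP[_ uq] /eqP <-]|[Aq uq]].
  by split=> //; apply/allP => j jq; rewrite /= support_indicator.
(* Four distinct entries inside a support of size 4 exhaust it. *)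
have /indicator_support wq : support w =i quad_seq q.
  move=> j; have sub : {subset quad_seq q <= enum (support w)}.
    by move=> k /(allP Aq) /=; rewrite mem_enum.
  have [|_ /(_ j)] := uniq_min_size uq sub.
    by rewrite -cardE -[#|_|]/(hamming_weight w) wt4.
  by rewrite mem_enum => ->.
by split; [rewrite uq -indicator_weight4 // wq w4 | apply/eqP].
Qed.

(** Two equal entries cancel, which forces the other two to agree; the [u] values cancel likewise,
    so every term is 1 and only a count remains. *)
Lemma sum_nonuniq_quad n (u : 'rV['F_2]_(2 ^ n - 1)) :
  \sum_(q | (\sum_(j <- quad_seq q) nonzero_vector j == 0) &&
          ~~ uniq (quad_seq q))
    sign int (\sum_(j <- quad_seq q) u 0 j)
  = 3 * (2 ^+ n - 1) ^+ 2 - 2 * (2 ^+ n - 1).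
Proof.
rewrite -card_nonzero_vector -[in RHS](card_ord (2 ^ n - 1)) -sum_quad_pairing.
rewrite big_mkcond; apply: eq_bigr => -[[i j] [k l]] _.
rewrite !sum_quad_seq /=.
rewrite !inE !negb_or ?orbF ?andbT.
pose h := @nonzero_vector n.
(* Regroupings that bring together the entries of each possible pairing. *)
have hik : h i + h j + (h k + h l) = h i + h k + (h j + h l) by rewrite addrACA.
have hil : h i + h j + (h k + h l) = h i + h l + (h j + h k).
  by rewrite [h k + _]addrC addrACA.
have uik : u 0 i + u 0 j + (u 0 k + u 0 l) = u 0 i + u 0 k + (u 0 j + u 0 l).
  by rewrite addrACA.
have uil : u 0 i + u 0 j + (u 0 k + u 0 l) = u 0 i + u 0 l + (u 0 j + u 0 k).
  by rewrite [u 0 k + _]addrC addrACA.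
have h2 := @nonzero_vector_add_eq0 n; rewrite -/h in h2 *.
have hxx x : h x + h x = 0 := rV_F2_addxx (h x).
have [eij|ij] := eqVneq i j.
  rewrite -eij hxx add0r h2 F2_addxx add0r andbT.
  have [<-|kl] := eqVneq k l; rewrite ?F2_addxx ?andbF /=.
    by have [_|_] := eqVneq i k.
  have [->|_] := eqVneq i k; last by rewrite !(mul0r, mulr0).
  by rewrite (negPf kl) !(mul0r, mulr0).
have [eik|ik] := eqVneq i k.
  rewrite hik uik -eik hxx F2_addxx !add0r h2 [j == i]eq_sym (negPf ij) /=.
  by have [<-|jl] := eqVneq j l; rewrite ?F2_addxx ?(negPf ij) ?andbT ?mulr0 ?mul0r.
have [eil|il] := eqVneq i l.
  rewrite hil uil -eil hxx F2_addxx !add0r h2.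
  by have [<-|jk] := eqVneq j k; rewrite ?F2_addxx ?andbT ?mulr0 ?mul0r.
(* With [i] distinct from the others the count is 0; a coincidence among [j], [k], [l] would force
   [i] to equal the remaining one. *)
rewrite !(mul0r, mulr0, add0r) oppr0 /=.
case: ifP => // /andP[]; have [ejk|jk] := eqVneq j k.
  by rewrite hil -ejk hxx addr0 h2 (negPf il).
have [ejl|jl] := eqVneq j l; first by rewrite hik -ejl hxx addr0 h2 (negPf ik).
have [<-|//] := eqVneq k l.
by rewrite hxx addr0 h2 (negPf ij).
Qed.

(** * Fourth moment and the lower bound *)

Lemma walsh_moment4 n (u : 'rV['F_2]_(2 ^ n - 1)) :
  \sum_a walsh u a ^+ 4 =
  2 ^+ n * (24 * char_sum int u + 3 * (2 ^+ n - 1) ^+ 2 - 2 * (2 ^+ n - 1)).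
Proof.
pose h := @nonzero_vector n.
have walsh4 a : walsh u a ^+ 4 = \sum_q sign int
  (\sum_(j <- quad_seq q) u 0 j + dotp a (\sum_(j <- quad_seq q) h j)).
  rewrite -[4%N]/(2 * 2)%N exprM sqr_sum_sign.
  rewrite (sqr_sum_sign (fun p : _ * _ => u 0 p.1 + u 0 p.2)
    (fun p => h p.1 + h p.2)).
  by apply: eq_bigr => q _; rewrite !sum_quad_seq.
under eq_bigr do rewrite walsh4.
rewrite sum_sum_sign (bigID (fun q => uniq (quad_seq q))) /=.
by rewrite sum_uniq_quad sum_nonuniq_quad !addrA.
Qed.

(** The roots (q-1)^2 and (q+1)^2 have sum 2(q^2+1) and product (q^2-1)^2, so only q^2 = 2^n enters
    and the two moments suffice. *)
Lemma walsh_product n (q : int) (u : 'rV['F_2]_(2 ^ n - 1)) : q ^+ 2 = 2 ^+ n ->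
  \sum_a (walsh u a ^+ 2 - (q - 1) ^+ 2) * (walsh u a ^+ 2 - (q + 1) ^+ 2) =
  2 ^+ n * 2 * (12 * char_sum int u + (2 ^+ n - 1) * (2 ^+ n - 4)).
Proof.
move=> q2.
rewrite (eq_bigr (fun a => walsh u a ^+ 4 - 2 * (2 ^+ n + 1) * walsh u a ^+ 2
  + (2 ^+ n - 1) ^+ 2)) => [|a _]; last by rewrite -q2; ring.
rewrite big_split sumrB /= -mulr_sumr walsh_moment4 walsh_moment2.
rewrite sumr_const card_mx card_Fp // mul1n -[_ *+ (2 ^ n)%N]mulr_natl natrX.
ring.
Qed.

Lemma walsh_product_ge0 n m (u : 'rV['F_2]_(2 ^ n - 1)) a : (0 < n)%N ->
  0 <= (walsh u a ^+ 2 - (2 * m - 1) ^+ 2) *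
       (walsh u a ^+ 2 - (2 * m + 1) ^+ 2).
Proof.
move=> n_gt0; have [z ->] := walsh_odd u a n_gt0.
(* The factors regroup into two products of consecutive integers, each nonnegative. *)
have -> : ((2 * z + 1) ^+ 2 - (2 * m - 1) ^+ 2) *
          ((2 * z + 1) ^+ 2 - (2 * m + 1) ^+ 2) =
   16 * (((z + m) * (z + m + 1)) * ((z - m) * (z - m + 1))) by ring.
have consec (x : int) : 0 <= x * (x + 1) by nia.
by rewrite mulr_ge0 // mulr_ge0.
Qed.

Lemma char_sum_ge n (u : 'rV['F_2]_(2 ^ n - 1)) : (2 <= n)%N -> ~~ odd n ->
  - ((2 ^+ n - 1) * (2 ^+ n - 4)) <= 12 * char_sum int u.
Proof.
move=> n_ge2 n_even; rewrite -subr_ge0 opprK.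
have pos : 0 < 2 ^+ n * 2 :> int by rewrite mulr_gt0 ?exprn_gt0.
rewrite -(pmulr_rge0 _ pos) -(@walsh_product n (2 ^+ n./2)); last first.
  by rewrite -exprM muln2 even_halfK.
(* Since n >= 2, q is even, so q - 1 and q + 1 are consecutive odd integers. *)
have -> : 2 ^+ n./2 = 2 * 2 ^+ n./2.-1 :> int.
  by rewrite -exprS prednK // half_gt0.
by apply: sumr_ge0 => a _; apply: walsh_product_ge0; apply: ltnW.
Qed.

(** * Bent functions attain the bound *)

(** The added 1 restores the term at x = 0, where [f] vanishes. *)
Lemma walsh_bent n (f : 'rV['F_2]_n -> bool) a : bent f -> f 0 = false ->
  `|walsh (punctured_tt f) a + 1| = 2 ^+ n./2.
Proof.
move=> /(_ a) <- f0; congr `|_|; rewrite (bigD1 0) //= f0 dotp0 addrC.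
congr (_ + _); rewrite /walsh.
rewrite -(sum_nonzero_vector (fun x => (-1) ^+ (f x + dotp a x)%N : int)).
apply: eq_bigr => j _; rewrite signD exprD mxE; congr (_ * _).
by case: (f _).
Qed.

Lemma char_sum_bent n (f : 'rV['F_2]_n -> bool) : ~~ odd n ->
  bent f -> f 0 = false ->
  12 * char_sum int (punctured_tt f) = - ((2 ^+ n - 1) * (2 ^+ n - 4)).
Proof.
move=> n_even bf f0; apply/eqP; rewrite -addr_eq0.
have pos : 2 ^+ n * 2 != 0 :> int by rewrite mulf_neq0 ?expf_neq0.
rewrite -(mulrI_eq0 _ (mulfI pos)) -(@walsh_product n (2 ^+ n./2)); last first.
  by rewrite -exprM muln2 even_halfK.
(* The Walsh sum is q - 1 or -(q + 1), so one factor is zero. *)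
apply/eqP/big1 => a _; have /eqP := walsh_bent a bf f0.
set w := walsh _ a; rewrite eqr_norml => /andP[/orP[]/eqP w1 _].
  by rewrite -w1; ring.
have -> : w = - (2 ^+ n./2 + 1) by rewrite -[2 ^+ _]opprK -w1; ring.
ring.
Qed.

Lemma sum_row_mx (V : nmodType) m1 m2 (F : 'rV['F_2]_(m1 + m2) -> V) :
  \sum_x F x = \sum_y \sum_z F (row_mx y z).
Proof.
rewrite pair_bigA (reindex (fun p : 'rV_m1 * 'rV_m2 => row_mx p.1 p.2)) //=.
exists (fun x : 'rV_(m1 + m2) => (lsubmx x, rsubmx x)) => [[y z] _ | x _] /=.
  by rewrite row_mxKl row_mxKr.
exact: hsubmxK.
Qed.

Lemma dotp_row_mx m1 m2 (a1 x1 : 'rV['F_2]_m1) (a2 x2 : 'rV['F_2]_m2) :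
  dotp (row_mx a1 a2) (row_mx x1 x2) = dotp a1 x1 + dotp a2 x2.
Proof.
rewrite /dotp big_split_ord /=; congr (_ + _); apply: eq_bigr => i _.
  by rewrite !row_mxEl.
by rewrite !row_mxEr.
Qed.

(* The Maiorana--McFarland function (y, z) |-> y . z. *)
Lemma bent_exists n : ~~ odd n ->
  exists f : 'rV['F_2]_n -> bool, bent f /\ f 0 = false.
Proof.
move=> n_even; pose m := n./2.
have : n = (m + m)%N by rewrite addnn even_halfK.
move: m => m n_mm; subst n; clear n_even.
exists (fun x => dotp (lsubmx x) (rsubmx x) != 0); split; last first.
  by rewrite !linear0 dotp0 eqxx.
move=> a; have -> : (m + m)%N./2 = m by rewrite addnn half_double.
rewrite sum_row_mx.
rewrite -[a]hsubmxK; set a1 := lsubmx a; set a2 := rsubmx a.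
have term y z :
    (-1) ^+ ((dotp (lsubmx (row_mx y z)) (rsubmx (row_mx y z)) != 0%R)
      + dotp (row_mx a1 a2) (row_mx y z))%N
    = sign int (dotp a1 y) * sign int (dotp z (y + a2)).
  rewrite row_mxKl row_mxKr dotp_row_mx exprD -/(sign int _).
  rewrite [dotp z _]dotpC dotpDl.
  have -> b : (-1) ^+ (b != 0%R :> 'F_2 : nat) = sign int b.
    by case: (F2_cases b) => ->.
  by rewrite !signD mulrCA.
(* The sum over [z] vanishes unless y = [a2], leaving one sign times 2^m. *)
under eq_bigr => y _.
  under eq_bigr do rewrite term.
  rewrite -mulr_sumr sum_sign_dotp addr_eq0 rV_F2_opp; over.
rewrite (bigD1 a2) //= eqxx big1 => [|y /negPf ->]; last by rewrite mulr0.
by rewrite addr0 normrM normr_sign mul1r ger0_norm ?exprn_ge0.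
Qed.

(** * Spectrum of the graph *)

Lemma intr_sign (R : numDomainType) b : (sign int b)%:~R = sign R b.
Proof. by rewrite /sign rmorphXn /= rmorphN1. Qed.

Lemma intr_char_sum (R : numDomainType) n (u : 'rV['F_2]_(2 ^ n - 1)) :
  (char_sum int u)%:~R = char_sum R u.
Proof. by rewrite rmorph_sum; apply: eq_bigr => w _; apply: intr_sign. Qed.

Lemma sum_even_code (V : nmodType) n
    (v : 'I_#|even_code n| -> 'rV['F_2]_(2 ^ n - 1))
    (F : 'rV['F_2]_(2 ^ n - 1) -> V) :
  injective v -> codom v =i even_code n ->
  \sum_i F (v i) = \sum_(w in even_code n) F w.
Proof.
move=> v_inj v_onto; rewrite -(eq_bigl _ _ v_onto) -big_uniq /=; last first.
  by rewrite map_inj_uniq ?enum_uniq.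
by rewrite big_map big_enum.
Qed.

Lemma even_weight4 n w :
  (w \in even_code n) && (hamming_weight w == 4%N) = (w \in weight4_code n).
Proof.
by rewrite !inE -andbA; case: (hamming_weight w =P 4%N) => [->|];
  rewrite ?andbF.
Qed.

Section Eigen.
Variables (R : rcfType) (n : nat).
Variable (v : 'I_#|even_code n| -> 'rV['F_2]_(2 ^ n - 1)).
Hypotheses (v_inj : injective v) (v_onto : codom v =i even_code n).

Let A : 'M[R]_#|even_code n| :=
  adjacency_mx R (fun x y => hamming_dist x y == 4%N) v.

Implicit Type u : 'rV['F_2]_(2 ^ n - 1).

Lemma listing_even i : v i \in even_code n.
Proof. by rewrite -v_onto codom_f. Qed.

(** Writing each neighbour of [v i] as [v i + w] with [w] of weight 4 factors out the sign at
    [v i]. *)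
Lemma adjacency_mul_sign_vector u :
  A *m sign_vector R u v = char_sum R u *: sign_vector R u v.
Proof.
apply/colP => i; rewrite !mxE; under eq_bigr do rewrite !mxE -/(sign R _).
rewrite (sum_even_code (fun w =>
  (hamming_dist (v i) w == 4%N)%:R * sign R (dotp u w))) //.
rewrite mulr_suml big_mkcond (reindex_inj (addrI (v i))) /= [RHS]big_mkcond.
apply: eq_bigr => w _; rewrite hamming_distE addrA rV_F2_addxx add0r.
have -> : (v i + w \in even_code n) = (w \in even_code n).
  apply/idP/idP => [|]; last exact/even_code_add/listing_even.
  by move=> /(even_code_add (listing_even i)); rewrite addrA rV_F2_addxx add0r.
rewrite -even_weight4 dotpDr signD; case: (w \in _) => //=.
by case: (_ == _); rewrite ?mul1r ?mul0r // mulrC.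
Qed.

(** Symmetry carries column eigenvectors to the row vectors used by [eigenvalue]. *)
Lemma trmx_adjacency : A^T = A.
Proof.
by apply/matrixP => i j; rewrite !mxE !hamming_distE addrC.
Qed.

Lemma sign_vector_neq0 u : sign_vector R u v != 0.
Proof.
have zero : 0 \in even_code n.
  rewrite !inE linear0 mulmx0 eqxx odd_hamming_weight negbK big1 // => i _.
  by rewrite mxE.
have /codomP[i _] : 0 \in codom v by rewrite v_onto.
apply/eqP => /colP/(_ i)/eqP; rewrite !mxE.
by rewrite expf_eq0 oppr_eq0 oner_eq0 andbF.
Qed.

Lemma eigenvalue_char_sum u : eigenvalue A (char_sum R u).
Proof.
apply/eigenvalueP; exists (sign_vector R u v)^T; last first.
  by rewrite -(inj_eq trmx_inj) trmxK trmx0 sign_vector_neq0.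
by rewrite -{1}trmx_adjacency -trmx_mul adjacency_mul_sign_vector linearZ.
Qed.

(* The characters span, so a nonzero eigenvector pairs nontrivially with one. *)
Lemma eigenvalue_is_char_sum b :
  eigenvalue A b -> exists u : 'rV['F_2]_(2 ^ n - 1), b = char_sum R u.
Proof.
move=> /eigenvalueP[x xA x_neq0].
have [u xu|x_orth] := pickP (fun u => (x *m sign_vector R u v) 0 0 != 0).
  exists u; apply: (mulIf xu).
  have := congr1 (fun y => (y *m sign_vector R u v) 0 0) xA.
  by rewrite -mulmxA adjacency_mul_sign_vector -scalemxAr -scalemxAl !mxE => ->.
case/rV0Pn: x_neq0 => j /eqP[].
(* Fourier inversion: this sum is a power of 2 times [x 0 j], so that entry is 0. *)
have : \sum_u sign R (dotp u (v j)) * (x *m sign_vector R u v) 0 0 = 0.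
  by apply: big1 => u _; have /eqP-> := x_orth u; rewrite mulr0.
have -> : \sum_u sign R (dotp u (v j)) * (x *m sign_vector R u v) 0 0
   = \sum_i x 0 i * \sum_u sign R (dotp u (v j + v i)).
  under eq_bigr do rewrite mxE mulr_sumr.
  rewrite exchange_big; apply: eq_bigr => i _; rewrite mulr_sumr.
  by apply: eq_bigr => u _; rewrite mxE -/(sign R _) dotpDr signD mulrCA.
rewrite (bigD1 j) //= [X in _ + X]big1 ?addr0 => [|i ij].
  rewrite sum_sign_dotp rV_F2_addxx eqxx => /eqP.
  by rewrite mulf_eq0 expf_eq0 pnatr_eq0 andbF orbF => /eqP.
rewrite sum_sign_dotp addr_eq0 rV_F2_opp (inj_eq v_inj) eq_sym.
by rewrite (negPf ij) mulr0.
Qed.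

End Eigen.

(* MathComp world. The listing v of the even-weight codewords is arbitrary. *)
Theorem proposition5 (R : rcfType) (n : nat) (n_ge2 : (2 <= n)%N)
    (n_even : ~~ odd n)
    (v : 'I_#|even_code n| -> 'rV['F_2]_(2 ^ n - 1))
    (v_inj : injective v) (v_onto : codom v =i even_code n) :
  let A : 'M[R]_#|even_code n| :=
    adjacency_mx R (fun x y => hamming_dist x y == 4%N) v in
  let lambda_min : R := - ((2 ^+ n - 1) * (2 ^+ n - 4) / 12) in
  is_min_eigenvalue A lambda_min /\
  (forall f : 'rV['F_2]_n -> bool, bent f -> f 0 = false ->
     is_eigenvector A lambda_min (sign_vector R (punctured_tt f) v)).
Proof.
move=> A lambda_min.
have lambdaE : lambda_min = (- ((2 ^+ n - 1) * (2 ^+ n - 4)))%:~R / 12.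
  by rewrite rmorphN rmorphM !rmorphB /= !rmorphXn /= mulNr.
have char_bent (f : 'rV_n -> bool) : bent f -> f 0 = false ->
    char_sum R (punctured_tt f) = lambda_min.
  move=> bf f0; rewrite lambdaE -(@char_sum_bent n f) // rmorphM /=.
  by rewrite intr_char_sum mulrC mulKf ?pnatr_eq0.
split; last first.
  move=> f bf f0; split; first exact: sign_vector_neq0.
  by rewrite -(char_bent f) // adjacency_mul_sign_vector.
split.
  (* A bent function vanishing at 0 shows that the bound is attained. *)
  have [f [bf f0]] := bent_exists n_even.
  by rewrite -(char_bent f) //; apply: eigenvalue_char_sum.
move=> b /eigenvalue_is_char_sum[//|//|u ->].
rewrite lambdaE ler_pdivrMr ?ltr0n // [_ * 12]mulrC -intr_char_sum.
by rewrite -[12]/(12%:~R) -rmorphM /= ler_int char_sum_ge.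
Qed.
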